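(* Let $2\le a<b$ be integers, let $\tau:=\log_a b$, let $\mathfrak S_{a,b}$ be the tree defined in the context, and let $\mathcal M$ be the centred Hardy--Littlewood maximal operator on $\mathfrak S_{a,b}$. The following hold: (i) if $a<b\le a^2$ and $p\in[1,\tau)$, then $\mathcal M$ is not of restricted weak type $(p,p)$ on $\mathfrak S_{a,b}$ (hence $\mathcal M$ is unbounded on $L^p(\mathfrak S_{a,b})$); (ii) if $b>a^2$, then $\mathcal M$ is not of restricted weak type $(p,p)$ on $\mathfrak S_{a,b}$ for every $p\in(1,\infty)$; hence $\mathcal M$ is bounded on $L^p(\mathfrak S_{a,b})$ if and only if $p=\infty$.
   Context: A tree is a connected graph with no loops (cycles), identified with its set of vertices; $\nu(x)$ is the number of neighbours of the vertex $x$. A tree carries the graph distance $d$ and the counting measure $\mu$; $|E|:=\mu(E)$, and $B_r(x):=\{y: d(x,y)\le r\}$. With $\mathbb N=\{0,1,2,\dots\}$, $$\mathcal M f(x):=\sup_{r\in\mathbb N}\frac1{|B_r(x)|}\int_{B_r(x)}|f|\,d\mu .$$ Horocycles: a geodesic ray is a sequence $\omega=\{\omega_n:n\in\mathbb N\}$ of vertices with $d(\omega_i,\omega_j)=|i-j|$ for all $i,j$. Given a geodesic ray $\omega$ starting at a reference vertex $o=\omega_0$, the height function is $h(x)=\lim_{m\to\infty}(m-d(x,\omega_m))\in\mathbb Z$, and the horocycles are $\mathfrak H_j=\{x: h(x)=j\}$, $j\in\mathbb Z$. The tree $\mathfrak S_{a,b}$: the tree with a fixed geodesic ray $\omega$ such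 that, with respect to the associated height function $h$, $\nu(x)=b+1$ for all vertices $x$ with $h(x)\ge1$ and $\nu(x)=a+1$ for all other vertices $x$ (those with $h(x)\le 0$). Lebesgue and Lorentz spaces are with respect to the counting measure. Putting $E_f(\lambda):=\{x:|f(x)|>\lambda\}$, the Lorentz (quasi-)norms are $\|f\|_{L^{p,q}}=\big(p\int_0^\infty |E_f(\lambda)|^{q/p}\lambda^{q-1}\,d\lambda\big)^{1/q}$ for $1\le q<\infty$ and $\|f\|_{L^{p,\infty}}=\sup_{\lambda>0}\lambda|E_f(\lambda)|^{1/p}$. An operator is of restricted weak type $(p,p)$ if it is bounded from $L^{p,1}$ to $L^{p,\infty}$ (for $p=1$: from $L^1=L^{1,1}$ to $L^{1,\infty}$). *)

(* Defs.v *)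
From HB Require Import structures.
From mathcomp Require Import all_boot all_order all_algebra.
From mathcomp Require Import all_classical all_reals all_analysis.

Set Implicit Arguments.
Unset Strict Implicit.
Unset Printing Implicit Defensive.
Import Order.TTheory GRing.Theory Num.Theory.
Import numFieldNormedType.Exports.

Local Open Scope classical_set_scope.
Local Open Scope ring_scope.

(* Alias carrying the discrete sigma-algebra, so that every function on the
   vertices is measurable and [counting] is a measure on them.  The point of a
   [pointedType], which [measurableType] requires, only says that the vertex
   set is nonempty. *)
Definition vertices (V : pointedType) : Type := V.
HB.instance Definition _ (V : pointedType) := Pointed.on (vertices V).
HB.instance Definition _ (V : pointedType) :=
  @isMeasurable.Build default_measure_display (vertices V)
    (@discrete_measurable (vertices V)) (@discrete_measurable0 _)
    (@discrete_measurableC _) (@discrete_measurableU _).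

Section graphs.
Context {V : pointedType}.
Implicit Types (adj : rel V) (x y : V) (w : nat -> V).

Definition walk adj (n : nat) x y : Prop :=
  exists s : seq V, [/\ path adj x s, last x s = y & size s = n].

Definition connected_graph adj : Prop := forall x y, exists n, walk adj n x y.

Definition acyclic_graph adj : Prop :=
  forall c : seq V, (2 < size c)%N -> uniq c -> ~~ cycle adj c.

Definition is_tree adj : Prop :=
  [/\ symmetric adj, irreflexive adj, connected_graph adj & acyclic_graph adj].

(* Least length of a walk from x to y (0 by convention if there is none,
   which does not happen in a connected graph). *)
Definition gdist adj x y : nat :=
  if pselect (exists n, `[< walk adj n x y >]) is left e then ex_minn e
  else 0%N.

Definition gball adj (r : nat) x : set V := [set y | (gdist adj x y <= r)%N].

(* nu(x) = n *)
Definition has_valence adj x (n : nat) : Prop := ([set y | adj x y] #= `I_n)%card.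

Definition geodesic_ray adj w : Prop :=
  forall i j : nat, gdist adj (w i) (w j) = absz (i%:Z - j%:Z).

(* The integer-valued height function, seen in R. *)
Definition height (R : realType) adj w x : R :=
  limn (fun m : nat => m%:R - (gdist adj x (w m))%:R : R).

Definition is_Sab (R : realType) (a b : nat) adj w : Prop :=
  [/\ is_tree adj, geodesic_ray adj w,
      forall x, 1 <= height R adj w x -> has_valence adj x b.+1
    & forall x, height R adj w x <= 0 -> has_valence adj x a.+1].

End graphs.

Local Open Scope ereal_scope.

Definition maximal {V : pointedType} {R : realType} (adj : rel V)
    (f : vertices V -> R) (x : vertices V) : \bar R :=
  ereal_sup [set (counting (gball adj r x))^-1 *
                 \int[counting]_(y in (gball adj r x : set (vertices V)))
                    `|(f y)%:E|
            | r in [set: nat]].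

Section lorentz.
Context d {T : measurableType d} {R : realType}.
Variable mu : {measure set T -> \bar R}.

Definition superlevel (f : T -> \bar R) (l : R) : set T :=
  [set x | l%:E < `|f x|].

Definition lorentz_norm (p : R) (q : \bar R) (f : T -> \bar R) : \bar R :=
  match q with
  | q%:E => (p%:E * \int[lebesgue_measure]_(l in `]0%R, +oo[)
               (mu (superlevel f l) `^ (q / p) * (l `^ (q - 1))%:E)) `^ q^-1
  | +oo => ereal_sup [set l%:E * mu (superlevel f l) `^ p^-1
                     | l in `]0%R, +oo[]
  | -oo => 0
  end.

Definition restricted_weak_type (M : (T -> R) -> T -> \bar R) (p : R) : Prop :=
  exists C : R, forall f : T -> R, measurable_fun [set: T] f ->
    lorentz_norm p 1 (EFin \o f) < +oo ->
    lorentz_norm p +oo (M f) <= C%:E * lorentz_norm p 1 (EFin \o f).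

Definition bounded_on_Lp (M : (T -> R) -> T -> \bar R) (p : \bar R) : Prop :=
  exists C : R, forall f : T -> R, measurable_fun [set: T] f ->
    'N[mu]_p[EFin \o f] < +oo ->
    'N[mu]_p[M f] <= C%:E * 'N[mu]_p[EFin \o f].

End lorentz.

Definition log_base {R : realType} (a b : R) : R := (ln b / ln a)%R.

(* Main.v *)
Require Import Defs.
From mathcomp Require Import all_boot all_order all_algebra.
From mathcomp Require Import all_classical all_reals all_analysis.
From mathcomp Require Import measurable_realfun ess_sup_inf.
From mathcomp Require Import finmap zify ring lra.
Import Order.TTheory GRing.Theory Num.Theory.
Import numFieldNormedType.Exports.
Local Open Scope classical_set_scope.
Local Open Scope ring_scope.

(** Every vertex has exactly one neighbour one level higher, its parent, so the
    tree is the genealogy of a single end: the ball of radius r about x consists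
    of the vertices that are i generations below the j-th ancestor of x with
    j + i <= r.  Going down, a vertex at height at least 1 has b children, any
    other vertex has a children, and the number of descendants after i
    generations depends only on the starting height.

    The counterexamples are indicators of sets of descendants of the ray vertex
    w_n.  Let E be its b ^ e descendants e generations below (e <= n), and F its
    b ^ n * a ^ k descendants n + k generations below, which lie at height -k.
    The ball of radius r = n + k + e about a point of F contains E.  If every
    family of descendants occurring in that ball has at most A members, then
    the ball has at most (r + 1) ^ 2 * A points, and so
    M 1_E >= b ^ e / ((r + 1) ^ 2 * A) on F.  Restricted weak type and strong
    type on L^p both imply t |F|^(1/p) <= K |E|^(1/p) whenever M 1_E >= t on F
    ([restricted_weak_type_test], [bounded_on_Lp_test]); the choice of n, k, e
    decides what this says ([indicator_estimate_growth]).

    If b <= a ^ 2, going up gains nothing: the families seen from height 0 have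
    at most a ^ r members ([ndesc_subquadratic]).  With E = {w_n} and k = 0 the
    estimate becomes (b ^ (1/p) / a) ^ n <= K (n + 1) ^ 2, which fails for large
    n when b ^ (1/p) > a, that is p < log_a b.

    If b > a ^ 2, climbing above height 0 dominates: seen from height -k, the
    families within distance 2n + k have at most b ^ n members as soon as
    a ^ (2n + k) <= b ^ n ([ndesc_superquadratic]), which holds for n = s k with
    s fixed ([superquadratic_exponent]).  With E the b ^ n descendants of w_n at
    height 0, M 1_E is, up to a factor quadratic in k, at least 1 on a set
    a ^ k times larger than E, and (a ^ (1/p)) ^ k <= K ((2s + 1) k + 1) ^ 2
    fails for every finite p. *)

(** * Distance in graphs and trees *)

Section graph_distance.
Context {V : pointedType} (adj : rel V).
Implicit Types (x y z t : V) (m n : nat).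

Lemma walk0 x : walk adj 0 x x.
Proof. by exists [::]. Qed.

Lemma walk1 x y : adj x y -> walk adj 1 x y.
Proof. by move=> xy; exists [:: y]; rewrite /= xy. Qed.

Lemma walk_cat m n x y z :
  walk adj m x y -> walk adj n y z -> walk adj (m + n) x z.
Proof.
move=> [s [ps <- <-]] [s' [ps' <- <-]].
by exists (s ++ s'); rewrite cat_path ps ps' last_cat size_cat.
Qed.

Lemma walkS_inv n x y :
  walk adj n.+1 x y -> exists2 z, adj x z & walk adj n z y.
Proof.
by move=> [[|z s] [] //= /andP[xz ps] <- [<-]]; exists z => //; exists s.
Qed.

Lemma walk0_inv x y : walk adj 0 x y -> x = y.
Proof. by move=> [[|z s] [_ <-]]. Qed.

Lemma walk_sym n x y : symmetric adj -> walk adj n x y -> walk adj n y x.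
Proof.
move=> adjC; elim: n x => [|n IHn] x; first by move/walk0_inv->; exact: walk0.
move=> /walkS_inv[z xz zy]; rewrite -addn1.
by apply: (walk_cat _ _ _ z); [exact: IHn|apply: walk1; rewrite adjC].
Qed.

Lemma gdist_le n x y : walk adj n x y -> (gdist adj x y <= n)%N.
Proof.
move=> wn; rewrite /gdist; case: pselect => [e|//].
by case: ex_minnP => m _; apply; exact/asboolP.
Qed.

Hypothesis conn : connected_graph adj.

Lemma gdist_walk x y : walk adj (gdist adj x y) x y.
Proof.
rewrite /gdist; case: pselect => [e|[]]; first by case: ex_minnP => m /asboolP.
by have [n wn] := conn x y; exists n; exact/asboolP.
Qed.

Lemma gdist_triangle x y z :
  (gdist adj x z <= gdist adj x y + gdist adj y z)%N.
Proof. by apply: gdist_le; apply: (walk_cat _ _ _ y); exact: gdist_walk. Qed.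

Lemma gdist_adj x y t : adj x y -> (gdist adj x t <= (gdist adj y t).+1)%N.
Proof.
move=> /walk1 xy; apply: gdist_le; rewrite -add1n.
by apply: walk_cat xy _; exact: gdist_walk.
Qed.

Lemma gdist_closer n x t :
  gdist adj x t = n.+1 -> exists2 y, adj x y & gdist adj y t = n.
Proof.
move=> dx; have := gdist_walk x t; rewrite dx => /walkS_inv[y xy /gdist_le dy].
exists y => //; apply/eqP; rewrite eqn_leq dy /=.
by rewrite -ltnS -dx gdist_adj.
Qed.

Lemma gdist0_eq x t : gdist adj x t = 0%N -> x = t.
Proof. by move=> dx; have := gdist_walk x t; rewrite dx => /walk0_inv. Qed.

End graph_distance.

Section tree_distance.
Context {V : pointedType} (adj : rel V).
Hypothesis tree : is_tree adj.
Implicit Types (x y z t : V) (m n : nat).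

(** The source of all cycles used below: descending from u and from v towards t
    until the two descents meet gives a simple path that stays at levels at most
    n.  The lower bound on its length makes it long enough to close up. *)
Lemma path_below_level n u v t : u != v ->
    gdist adj u t = n -> gdist adj v t = n ->
  exists s, [/\ path adj u s, last u s = v, uniq (u :: s),
    all (fun z => gdist adj z t <= n)%N (u :: s) & (1 < size s)%N].
Proof.
have [adjC _ conn _] := tree.
elim: n u v => [|n IHn] u v uv du dv.
  move: uv; rewrite (gdist0_eq adj conn _ _ du).
  by rewrite (gdist0_eq adj conn _ _ dv) eqxx.
have [u' uu' du'] := gdist_closer adj conn _ _ _ du.
have [v' vv' dv'] := gdist_closer adj conn _ _ _ dv.
have neqd z z' : gdist adj z t = n.+1 -> gdist adj z' t = n -> z != z'.
  by move=> dz dz'; apply/eqP => zz'; move: dz; rewrite zz' dz'; lia.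
have [eu|nu] := eqVneq u' v'.
  exists [:: u'; v]; split => //=.
  - by rewrite uu' eu adjC vv'.
  - by rewrite !inE negb_or uv neqd//= andbT eq_sym neqd.
  - by rewrite du du' dv leqnn leqnSn.
have [s [ps ls us ds ss]] := IHn _ _ nu du' dv'.
have notin z : gdist adj z t = n.+1 -> z \notin u' :: s.
  by move=> dz; apply/negP => /(allP ds); rewrite dz ltnn.
exists (u' :: rcons s v); split.
- by rewrite /= uu' rcons_path ps ls adjC vv'.
- by rewrite /= last_rcons.
- rewrite cons_uniq -rcons_cons rcons_uniq us andbT mem_rcons inE negb_or uv.
  by rewrite !notin.
- rewrite -rcons_cons /= -/(all _ (rcons (u' :: s) v)) all_rcons dv du leqnn /=.
  by apply: sub_all ds => z; exact: leqW.
- by rewrite /= size_rcons.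
Qed.

(** Two adjacent vertices at the same distance from t would close the path of
    [path_below_level] into a cycle. *)
Lemma gdist_adj_neq x y t : adj x y -> gdist adj x t != gdist adj y t.
Proof.
have [adjC adjI conn acyc] := tree; move=> xy; apply/eqP => dxy.
have xNy : x != y by apply/eqP => e; move: xy; rewrite e adjI.
have [s [ps ls us _ ss]] := path_below_level _ x y t xNy dxy erefl.
by have /negP := acyc (x :: s) ss us; rewrite /= rcons_path ps ls adjC xy.
Qed.

(** If y and y' were distinct, the path from y to y' below the level of x would
    close into a cycle through x. *)
Lemma closer_unique x y y' t : adj x y -> adj x y' ->
  gdist adj x t = (gdist adj y t).+1 -> gdist adj x t = (gdist adj y' t).+1 ->
  y = y'.
Proof.
have [adjC adjI conn acyc] := tree; move=> xy xy' dy dy'.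
apply/eqP/negPn/negP => yy'.
have [||s [ps ls us ds ss]] := path_below_level (gdist adj y t) _ _ t yy' => //.
  by case: dy'; rewrite dy => -[].
have xs : x \notin y :: s by apply/negP => /(allP ds); rewrite dy ltnn.
have uxs : uniq [:: x, y & s] by rewrite cons_uniq xs us.
have /negP := acyc (x :: y :: s) (ltnW ss) uxs; apply.
by rewrite /= rcons_path xy ps ls adjC xy'.
Qed.

End tree_distance.

(** * The parent map and the height function *)

Section horocycles.
Context {V : pointedType} (adj : rel V) (w : nat -> V).
Hypotheses (tree : is_tree adj) (ray : geodesic_ray adj w).
Implicit Types (x y : V) (m : nat).

Lemma ray_distance m : gdist adj (w m) (w m.+1) = 1%N.
Proof. by rewrite ray; lia. Qed.

(** The sequence m - d(x, w_m) is nondecreasing and bounded by d(w_0, x), hence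
    stationary, being integral. *)
Lemma height_stationary x : exists c : int, exists M, forall m, (M <= m)%N ->
  m%:Z - (gdist adj x (w m))%:Z = c.
Proof.
have [_ _ conn _] := tree.
(* the nonnegative gap between d(w_0, x) and m - d(x, w_m) *)
pose g m := (gdist adj (w 0%N) x + gdist adj x (w m) - m)%N.
have mg m : (m <= gdist adj (w 0%N) x + gdist adj x (w m))%N.
  have := gdist_triangle adj conn (w 0%N) x (w m); rewrite ray; lia.
have gS m : (g m.+1 <= g m)%N.
  have := gdist_triangle adj conn x (w m) (w m.+1).
  rewrite ray_distance /g; have := mg m; have := mg m.+1; lia.
have gle m n : (m <= n)%N -> (g n <= g m)%N.
  elim: n => [|n IHn]; first by rewrite leqn0 => /eqP->.
  rewrite leq_eqVlt => /predU1P[->//|/IHn]; exact: leq_trans (gS n).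
have exg : exists k, `[< exists M, g M = k >].
  by exists (g 0%N); apply/asboolP; exists 0%N.
case: (ex_minnP exg) => k /asboolP[M gM] kmin.
exists ((gdist adj (w 0%N) x)%:Z - k%:Z), M => m Mm.
have gm : g m = k.
  apply/eqP; rewrite eqn_leq -{1}gM gle//=; apply: kmin.
  by apply/asboolP; exists m.
by have := mg m; move: gm; rewrite /g; lia.
Qed.

Lemma height_eventually (R : realType) x (c : int) (M : nat) :
    (forall m, (M <= m)%N -> m%:Z - (gdist adj x (w m))%:Z = c) ->
  height R adj w x = c%:~R.
Proof.
move=> Mc; apply: cvg_lim => //; apply: cvg_near_cst.
by exists M => // m /= /Mc <-; rewrite intrB.
Qed.

(** The neighbour of x closest to w_m, for m past the point where the height of
    x is reached, remains the closest one to all later w_m; it is therefore one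
    level above x, and uniqueness of closer neighbours makes it the only one. *)
Lemma horocyclic_structure (R : realType) :
  exists (par : V -> V) (h : V -> int),
  [/\ forall x y, adj x y = (y == par x) || (x == par y),
      forall x, h (par x) = h x + 1,
      forall n, h (w n) = n%:Z &
      forall x, height R adj w x = (h x)%:~R].
Proof.
have [adjC _ conn _] := tree.
have [h hP] := choice height_stationary.
(* the neighbour of x towards w_m0 *)
have up x : exists y, adj x y /\ h y = h x + 1.
  have [M HM] := hP x.
  have [m0 Mm0 hm0] : exists2 m0, (M <= m0)%N & (absz (h x) < m0)%N.
    by exists (maxn M (absz (h x)).+1); lia.
  have : gdist adj x (w m0) != 0%N by have := HM m0 Mm0; lia.
  case E : (gdist adj x (w m0)) => [//|d] _.
  have [y xy dy] := gdist_closer adj conn _ _ _ E.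
  exists y; split => //; have [M' HM'] := hP y.
  have closer k : (gdist adj y (w (m0 + k)%N)).+1 = gdist adj x (w (m0 + k)%N).
    elim: k => [|k IHk]; first by rewrite addn0 dy E.
    rewrite addnS.
    have := gdist_triangle adj conn y (w (m0 + k)%N) (w (m0 + k).+1).
    rewrite ray_distance.
    have := gdist_adj adj conn _ _ (w (m0 + k).+1) xy.
    have := HM (m0 + k)%N; have := HM (m0 + k).+1; lia.
  have := HM (m0 + M')%N; have := HM' (m0 + M')%N.
  by have := closer M'; lia.
have [par parP] := choice up.
have adj_h x y : adj x y -> h y = h x + 1 \/ h x = h y + 1.
  move=> xy; have [M HM] := hP x; have [M' HM'] := hP y.
  have := HM (M + M')%N (leq_addr _ _); have := HM' (M + M')%N (leq_addl _ _).
  have := gdist_adj adj conn _ _ (w (M + M')%N) xy.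
  move: (xy); rewrite adjC => /(gdist_adj adj conn _ _ (w (M + M')%N)).
  have := gdist_adj_neq adj tree _ _ (w (M + M')%N) xy.
  by lia.
have up_unique x y y' : adj x y -> adj x y' -> h y = h x + 1 ->
    h y' = h x + 1 -> y = y'.
  move=> xy xy' hy hy'; have [M HM] := hP x.
  have [M1 HM1] := hP y; have [M2 HM2] := hP y'.
  have [m [Mm M1m M2m]] : exists m, [/\ M <= m, M1 <= m & M2 <= m]%N.
    by exists (M + M1 + M2)%N; split; lia.
  apply: (closer_unique adj tree x _ _ (w m) xy xy').
    by have := HM m; have := HM1 m; lia.
  by have := HM m; have := HM2 m; lia.
exists par, h; split.
- move=> x y; apply/idP/orP => [xy|[/eqP->|/eqP->]]; last 2 first.
  + by have [] := parP x.
  + by rewrite adjC; have [] := parP y.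
  have [hy|hx] := adj_h _ _ xy; [left|right].
    by apply/eqP; apply: (up_unique x) => //; have [] := parP x.
  apply/eqP; apply: (up_unique y) => //; last 1 first.
  + by have [] := parP y.
  + by rewrite adjC.
  + by have [] := parP y.
- by move=> x; have [] := parP x.
- move=> n; have [M HM] := hP (w n); rewrite -(HM (M + n)%N (leq_addr _ _)) ray.
  by lia.
- by move=> x; have [M HM] := hP x; exact: height_eventually HM.
Qed.

End horocycles.

(** * Counting descendants and the size of balls *)

Lemma size_flatten_leq (T : eqType) (ss : seq (seq T)) (A : nat) :
  (forall s, s \in ss -> (size s <= A)%N) ->
  (size (flatten ss) <= size ss * A)%N.
Proof.
elim: ss => [//|s ss IHss] sA.
rewrite /= size_cat mulSn leq_add ?sA ?mem_head//.
by apply: IHss => s' s's; rewrite sA// inE s's orbT.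
Qed.

Lemma leq_expn2r (m n e : nat) : (m <= n)%N -> (m ^ e <= n ^ e)%N.
Proof. by case: e => // e; rewrite leq_exp2r. Qed.

(** The l-th generation below a vertex of height H lies at height H - l; this is
    the number of its i-th generation descendants ([descendants]). *)
Definition ndesc (a b : nat) (H : int) (i : nat) : nat :=
  (\prod_(l < i) (if (1 <= H - l%:Z)%R then b else a))%N.

Lemma ndescE (a b : nat) (H : int) (i : nat) (m := minn i `|Num.max H 0|%N) :
  ndesc a b H i = (b ^ m * a ^ (i - m))%N.
Proof.
rewrite {}/m /ndesc; elim: i => [|i IHi]; first by rewrite big_ord0 min0n.
rewrite big_ord_recr /= IHi; case: ifPn => Hi.
  have -> : minn i `|Num.max H 0|%N = i by lia.
  have -> : minn i.+1 `|Num.max H 0|%N = i.+1 by lia.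
  by rewrite !subnn !muln1 expnSr.
have -> : minn i.+1 `|Num.max H 0|%N = `|Num.max H 0|%N by lia.
have -> : minn i `|Num.max H 0|%N = `|Num.max H 0|%N by lia.
by rewrite subSn ?expnSr ?mulnA//; lia.
Qed.

Lemma ndesc_from_height (a b n k : nat) :
  ndesc a b n%:Z (n + k) = (b ^ n * a ^ k)%N.
Proof.
rewrite ndescE; have -> : minn (n + k) `|Num.max n%:Z 0|%N = n by lia.
by rewrite addKn.
Qed.

(** The m <= min(i, j) generations that multiply by b cost at most a ^ 2 each,
    and the surplus a ^ m is paid for by the j steps up. *)
Lemma ndesc_subquadratic (a b r j i : nat) : (0 < a)%N -> (b <= a ^ 2)%N ->
  (j + i <= r)%N -> (ndesc a b j%:Z i <= a ^ r)%N.
Proof.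
move=> a0 ba jir; rewrite ndescE; set m := minn _ _.
have [mi mj] : (m <= i)%N /\ (m <= j)%N by rewrite /m; lia.
apply: (@leq_trans ((a ^ 2) ^ m * a ^ (i - m))%N).
  by rewrite leq_mul2r; rewrite leq_expn2r ?orbT.
by rewrite -expnM -expnD leq_pexp2l//; lia.
Qed.

(** Of the i generations, m multiply by b and i - m by a <= b ^ (1/2).  If m > 0
    the j steps up first had to climb from -k, so that 2m + (i - m) <= 2n; if
    m = 0 the descent never leaves the region of valence a + 1. *)
Lemma ndesc_superquadratic (a b n k j i : nat) : (0 < a)%N -> (a ^ 2 <= b)%N ->
  (a ^ (2 * n + k) <= b ^ n)%N -> (j + i <= 2 * n + k)%N ->
  (ndesc a b (j%:Z - k%:Z) i <= b ^ n)%N.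
Proof.
move=> a0 ab abn jir; rewrite ndescE; set m := minn _ _.
have b0 : (0 < b)%N by apply: leq_trans ab; rewrite expn_gt0 a0.
have [m0|m0] := posnP m.
  rewrite m0 mul1n subn0; apply: leq_trans abn; rewrite leq_pexp2l//; lia.
(* squaring avoids the square root of b *)
rewrite -(@leq_exp2r _ _ 2)// expnMn -!expnM.
apply: (@leq_trans (b ^ (m * 2) * b ^ (i - m))%N).
  by rewrite leq_mul2l (mulnC (i - m)%N) (expnM a); rewrite leq_expn2r ?orbT.
rewrite -expnD leq_pexp2l//; move: m0; rewrite /m; lia.
Qed.

Section parents.
Context {V : pointedType} (adj : rel V) (par : V -> V) (h : V -> int).
Context (a b : nat).
Hypothesis adjE : forall x y, adj x y = (y == par x) || (x == par y).
Hypothesis h_par : forall x, h (par x) = h x + 1.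
Hypothesis valence : forall x,
  has_valence adj x (if 1 <= h x then b else a).+1.
Implicit Types (x y z : V) (i j n r : nat).

Lemma h_iter i x : h (iter i par x) = h x + i%:Z.
Proof. by elim: i => [|i IHi] /=; rewrite ?addr0// h_par IHi; lia. Qed.

Lemma children y : exists s : seq V, [/\ uniq s,
  forall z, (z \in s) = (par z == y) & size s = if 1 <= h y then b else a].
Proof.
pose A := [set z | adj y z].
have val : (A #= `I_(if (1 <= h y)%R then b else a).+1)%card := valence y.
have finA : finite_set A by exists (if 1 <= h y then b else a).+1.
have memA z : (z \in fset_set A) = adj y z.
  by rewrite in_fset_set//; apply/idP/idP => [/set_mem//|?]; exact/mem_set.
exists (rem (par y) (fset_set A)); split.
- exact/rem_uniq/fset_uniq.
- move=> z; rewrite mem_rem_uniq ?fset_uniq// inE memA adjE (eq_sym _ y).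
  case: eqVneq => //= zy; apply/esym/eqP => yz.
  by have := h_par z; rewrite -yz zy h_par; lia.
- rewrite size_rem; last by rewrite memA adjE eqxx.
  by rewrite -[size _]/(#|` _|)%fset (card_fset_set val).
Qed.

Lemma descendants y i : exists s : seq V, [/\ uniq s,
  forall x, (x \in s) = (iter i par x == y) & size s = ndesc a b (h y) i].
Proof.
have [ch chP] := choice children.
elim: i => [|i [s [us ms ss]]].
  exists [:: y]; split => // [x|]; first by rewrite inE.
  by rewrite /ndesc big_ord0.
exists [seq x | z <- s, x <- ch z]; split.
- apply: allpairs_uniq_dep => //.
    by move=> z _; have [] := chP z.
  move=> _ _ /allpairsPdep[z [x [zs xz ->]]]
    /allpairsPdep[z' [x' [zs' xz' ->]]].
  move=> /= xx; move: xz xz'; have [_ -> _] := chP z.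
  by have [_ -> _] := chP z'; rewrite -xx => /eqP <- /eqP <-.
- move=> x; apply/allpairsPdep/idP => [[z [x' [zs xz ->]]]|].
    move: zs xz; rewrite ms; have [_ -> _] := chP z => zs /eqP xz.
    by rewrite iterSr xz.
  rewrite iterSr -ms => xs; exists (par x), x; split => //.
  by have [_ -> _] := chP (par x).
- rewrite size_allpairs_dep /ndesc big_ord_recr -/(ndesc a b (h y) i) -ss /=.
  rewrite sumnE big_map big_seq.
  rewrite (eq_bigr (fun=> if 1 <= h y - i%:Z then b else a)).
    by rewrite -big_seq big_const_seq count_predT iter_addn_0 mulnC.
  move=> z; have [_ _ ->] := chP z; rewrite ms => /eqP <-.
  by rewrite h_iter addrK.
Qed.

(** In a genealogy a walk can be shortened to one that goes only up, then only
    down: the parent being unique, a step down followed by a step up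
    backtracks. *)
Lemma walk_confluent r x y : walk adj r x y ->
  exists j i, (j + i <= r)%N /\ iter j par x = iter i par y.
Proof.
elim: r x => [|r IHr] x; first by move/walk0_inv->; exists 0%N, 0%N.
move=> /walkS_inv[x']; rewrite adjE => /orP[/eqP->|/eqP->] /IHr[j [i [jir e]]].
  by exists j.+1, i; rewrite iterSr.
case: j => [|j] in jir e *.
  by exists 0%N, i.+1; split => //=; rewrite -e.
by exists j, i; split; [lia|rewrite -e iterSr].
Qed.

Lemma walk_iter i x : walk adj i x (iter i par x).
Proof.
elim: i => [|i IHi]; first exact: walk0.
by rewrite -addn1; apply: walk_cat IHi _; apply: walk1; rewrite addn1 adjE eqxx.
Qed.

Hypothesis conn : connected_graph adj.

Lemma gball_bound (r A : nat) x :
    (forall j i, (j + i <= r)%N -> (ndesc a b (h x + j%:Z) i <= A)%N) ->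
  exists s : seq V, gball adj r x `<=` [set` s] /\ (size s <= r.+1 ^ 2 * A)%N.
Proof.
move=> rA.
have /choice[D DP] : forall ji : nat * nat, exists s : seq V, (size s <= A)%N /\
    forall y, (ji.1 + ji.2 <= r)%N ->
      iter ji.1 par x = iter ji.2 par y -> y \in s.
  case=> j i /=; have [jir|] := leqP (j + i) r; last by exists [::].
  have [s [_ ms ss]] := descendants (iter j par x) i.
  exists s; split; first by rewrite ss h_iter rA.
  by move=> y _ e; rewrite ms e.
pose idx := [seq (j, i) | j <- iota 0 r.+1, i <- iota 0 r.+1].
exists (flatten [seq D ji | ji <- idx]); split.
  move=> y /= yr.
  have /walk_confluent[j [i [jir e]]] := gdist_walk adj conn x y.
  have jir' := leq_trans jir yr.
  suff : y \in flatten [seq D ji | ji <- idx] by [].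
  apply/flatten_mapP; exists (j, i); last by have [_] := DP (j, i); apply.
  by apply/allpairsP; exists (j, i); rewrite !mem_iota /=; split => //; lia.
rewrite (leq_trans (size_flatten_leq _ _ A _))//.
  by move=> s /mapP[ji _ ->]; have [] := DP ji.
by rewrite size_map size_allpairs !size_iota mulnn.
Qed.

End parents.

(** E and F are the descendants of w_n at heights n - e and -k; a point of F
    reaches any point of E by climbing n + k steps to w_n and going down e. *)
Lemma descendant_test_sets (R : realType) (a b : nat) (V : pointedType)
    (adj : rel V) (w : nat -> V) : is_Sab R a b adj w ->
  forall n k e A : nat, (e <= n)%N ->
  (forall j i, (j + i <= n + k + e)%N ->
     (ndesc a b (j%:Z - k%:Z) i <= A)%N) ->
  exists E F : seq V,
    [/\ uniq E, uniq F, size E = (b ^ e)%N, size F = (b ^ n * a ^ k)%N &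
     forall x, x \in F -> [set` E] `<=` gball adj (n + k + e) x /\
      exists s : seq V, gball adj (n + k + e) x `<=` [set` s] /\
        (size s <= (n + k + e).+1 ^ 2 * A)%N].
Proof.
move=> [tree ray valb vala] n k e A en nA.
have [adjC _ conn _] := tree.
have [par [h [adjE h_par h_w hR]]] := horocyclic_structure adj w tree ray R.
have val x : has_valence adj x (if 1 <= h x then b else a).+1.
  case: ifPn => hx; [apply: valb|apply: vala]; rewrite hR.
    by rewrite ler1z.
  by rewrite lerz0; lia.
have [E [uE mE sE]] := descendants adj par h a b adjE h_par val (w n) e.
have [F [uF mF sF]] := descendants adj par h a b adjE h_par val (w n) (n + k).
exists E, F; split => //.
- rewrite sE h_w ndescE (_ : minn _ _ = e) ?subnn ?muln1//; lia.
- by rewrite sF h_w ndesc_from_height.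
- move=> x; rewrite mF => /eqP xw; split.
    move=> y /=; rewrite mE => /eqP yw; apply: gdist_le.
    apply: (walk_cat _ _ _ _ (w n)).
      by rewrite -xw; apply: (walk_iter adj par).
    by apply: walk_sym => //; rewrite -yw; apply: (walk_iter adj par).
  have hx : h x = - k%:Z.
    by have := h_iter par h h_par (n + k) x; rewrite xw h_w; lia.
  apply: (gball_bound adj par h a b) => // j i /nA.
  by rewrite hx addrC.
Qed.

(** * The maximal operator on indicators and on bounded functions *)

Section counting_seq.
Context {R : realType} {T : choiceType}.
Local Open Scope ereal_scope.

Lemma counting_seq (s : seq T) :
  uniq s -> counting [set` s] = (size s)%:R%:E :> \bar R.
Proof.
move=> us; rewrite /counting asboolT; last exact: finite_seq.
congr (_%:R%:E); apply/perm_size/uniq_perm => //.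
move=> x; rewrite in_fset_set ?finite_seq//.
by apply/idP/idP => [/set_mem//|?]; exact/mem_set.
Qed.

Lemma counting_sub_seq (A : set T) (s : seq T) : A `<=` [set` s] ->
  exists2 m, (m <= size s)%N & counting A = m%:R%:E :> \bar R.
Proof.
move=> As; have finA : finite_set A by exact: sub_finite_set As (finite_seq s).
rewrite /counting asboolT//; exists #|` fset_set A|%fset => //.
apply: uniq_leq_size => //.
by move=> x; rewrite in_fset_set// => /set_mem/As.
Qed.

End counting_seq.

Section maximal_operator.
Context {R : realType} {V : pointedType} (adj : rel V).
Local Open Scope ereal_scope.
Local Notation mu := (counting : {measure set (vertices V) -> \bar R}).

Lemma measurable_vertices (A : set (vertices V)) : measurable A.
Proof. by []. Qed.

Lemma le_counting (A B : set (vertices V)) : A `<=` B -> mu A <= mu B.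
Proof.
by move=> AB; apply: le_measure => //; exact/mem_set/measurable_vertices.
Qed.

Lemma maximal_indic_ge (E s : seq V) (r : nat) (x : V) : uniq E ->
    (0 < size E)%N -> [set` E] `<=` gball adj r x ->
    gball adj r x `<=` [set` s] ->
  ((size E)%:R / (size s)%:R)%:E <=
    maximal adj (\1_[set` E] : vertices V -> R) x.
Proof.
move=> uE E0 Er rs; apply: le_trans; last first.
  by apply: ereal_sup_ubound; exact: (imageP _ (I : [set: nat] r)).
have [m ms cm] := @counting_sub_seq R _ _ _ rs.
have Em : (size E <= m)%N.
  rewrite -(ler_nat R) -lee_fin -cm -(counting_seq _ uE).
  exact: le_counting.
rewrite [X in _ * X](_ : _ = (size E)%:R%:E); last first.
  under eq_integral do rewrite abse_EFin ger0_norm//.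
  rewrite integral_indic// -(counting_seq _ uE); congr counting.
  exact/setIidPl.
have m0 : (0 < m)%N by exact: leq_trans Em.
rewrite cm inver pnatr_eq0 gtn_eqF// -EFinM lee_fin mulrC.
by rewrite ler_wpM2r// lef_pV2 ?posrE ?ltr0n ?ler_nat//; exact: leq_trans ms.
Qed.

(** A ball of infinite measure would contribute 0 to the supremum, since the
    inverse of +oo is 0. *)
Lemma maximal_le (f : vertices V -> R) (c : R) x :
  (forall y, `|f y| <= c)%R -> maximal adj f x <= c%:E.
Proof.
move=> fc; have c0 : (0 <= c)%R by exact: le_trans (fc x).
apply: ge_ereal_sup => _ [r _ <-].
have le_int :
    \int[mu]_(y in gball adj r x) `|(f y)%:E| <= c%:E * mu (gball adj r x).
  rewrite -integral_cst//; apply: ge0_le_integral => //.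
  by move=> y _; rewrite /= lee_fin.
have ball0 : [set` [:: x]] `<=` gball adj r x.
  move=> y; rewrite /= inE => /eqP ->.
  by rewrite /gball/= (leq_trans (gdist_le _ _ _ _ (walk0 adj x))).
have mu_gt0 : 0 < mu (gball adj r x).
  apply: (@lt_le_trans _ _ (mu [set` [:: x]])).
    by rewrite /= counting_seq.
  exact: le_counting.
move: le_int mu_gt0; rewrite /=.
case: (counting (gball adj r x)) => [m| |] // le_int mu_gt0; last first.
  by rewrite /inve mul0e lee_fin.
rewrite lte_fin in mu_gt0; rewrite inver gt_eqF//.
apply: (@le_trans _ _ ((m^-1)%:E * (c%:E * m%:E))).
  by rewrite lee_wpmul2l// lee_fin invr_ge0 ltW.
by rewrite -!EFinM lee_fin mulrCA mulVf ?mulr1// gt_eqF.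
Qed.

Lemma maximal_ge0 (f : vertices V -> R) x : 0 <= maximal adj f x.
Proof.
apply: le_trans; last first.
  by apply: ereal_sup_ubound; exact: (imageP _ (I : [set: nat] 0%N)).
apply: mule_ge0; last exact: integral_ge0.
by rewrite inve_ge0; exact: (measure_ge0 mu).
Qed.

(** Only the empty set is negligible for the counting measure, so the essential
    supremum bounds the function everywhere. *)
Lemma maximal_bounded_Loo : bounded_on_Lp mu (maximal adj) +oo.
Proof.
exists 1%R => f _; rewrite mul1e unlock; case: ifPn => // mu0 foo.
have fS x : `|(f x)%:E| <= ess_sup mu (abse \o (EFin \o f)).
  have [N [_ N0 NP]] := ess_sup_ge mu (abse \o (EFin \o f)).
  apply: contrapT => /NP Nx.
  have : mu [set` [:: x]] <= mu N.
    apply: le_counting.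
    by move=> y; rewrite /= inE => /eqP ->.
  by rewrite N0 /= counting_seq// lee_fin ler10.
case: (ess_sup _ _) foo fS => [c _ fS| //|_ fS].
- apply/ess_supP; apply: aeW => x /=.
  rewrite gee0_abs ?maximal_ge0//; apply: maximal_le => y.
  by have := fS y; rewrite lee_fin.
- by have := fS point.
Qed.

End maximal_operator.

Section test_inequality.
Context {R : realType} {V : pointedType}.
Variable M : (vertices V -> R) -> vertices V -> \bar R.
Local Notation mu := (counting : {measure set (vertices V) -> \bar R}).
Local Open Scope ereal_scope.

(** What restricted weak type and strong type (p, p) have in common when tested
    on an indicator: the L^(p,1) and L^p norms of 1_E are both proportional to
    |E|^(1/p). *)
Definition indicator_estimate (p : R) : Prop := exists K : R,
  forall (E F : set (vertices V)) (e phi t : R), mu E = e%:E -> mu F = phi%:E ->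
    (0 < t)%R -> (forall x, F x -> t%:E <= M \1_E x) ->
  (t * phi `^ p^-1 <= K * e `^ p^-1)%R.

Lemma lorentz_norm_p1_indic (p e : R) (E : set (vertices V)) :
  (0 < p)%R -> mu E = e%:E ->
  lorentz_norm mu p 1 (EFin \o \1_E) = (p * e `^ p^-1)%:E.
Proof.
move=> p0 muE; rewrite /lorentz_norm invr1 poweRe1; last first.
  apply: mule_ge0; first by rewrite lee_fin ltW.
  apply: integral_ge0 => l _.
  by rewrite mule_ge0 ?poweR_ge0 ?lee_fin ?powR_ge0.
rewrite EFinM; congr (_ * _).
transitivity (\int[lebesgue_measure]_(l in `]0%R, +oo[)
    ((e `^ p^-1)%:E * (\1_(`]0%R, 1%R[%classic : set R) l)%:E)).
  apply: eq_integral => l /set_mem; rewrite /= in_itv/= andbT => l0.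
  rewrite subrr powRr0 mule1 mul1r indicE.
  have [l1|l1] := ltP l 1%R.
    rewrite mem_set/= ?in_itv/= ?l0// mule1 -poweR_EFin -muE.
    congr (counting _ `^ _); apply/seteqP.
    split => y; rewrite /superlevel /= indicE.
      case: (boolP (y \in E)) => [/set_mem//|_].
      by rewrite normr0 lte_fin ltNge (ltW l0).
    by move=> /mem_set ->; rewrite normr1 lte_fin.
  rewrite memNset/= ?in_itv/= ?l0 ?ltNge ?l1// mule0.
  rewrite (_ : superlevel _ _ = set0) ?measure0 ?poweR0r ?invr_eq0 ?gt_eqF//.
  rewrite -subset0 => y; rewrite /superlevel /= lte_fin indicE ltNge.
  by case: (y \in E); rewrite ?normr0 ?normr1 ?l1// (le_trans _ l1).
rewrite ge0_integralZl_EFin//; last 2 first.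
- exact/measurable_EFinP/measurable_indic.
- exact: powR_ge0.
rewrite integral_indic// setIidl; last first.
  by move=> l /=; rewrite !in_itv/= => /andP[->].
by rewrite /= lebesgue_measure_itv/= lte_fin ltr01 oppr0 adde0 mule1.
Qed.

(** The superlevel sets in the weak norm are strict, so F is compared with the
    superlevel set at height t / 2; this and the norm of 1_E give K = 2 C p. *)
Lemma restricted_weak_type_test (p : R) : (0 < p)%R ->
  restricted_weak_type mu M p -> indicator_estimate p.
Proof.
move=> p0 [C CP]; exists (2 * C * p)%R => E F e phi t muE muF t0 tF.
have := CP \1_E.
rewrite (lorentz_norm_p1_indic _ _ _ p0 muE) => /(_ _ (ltry _)) {}CP.
suff : (2^-1 * t * phi `^ p^-1 <= C * (p * e `^ p^-1))%R by lra.
rewrite -lee_fin [leRHS]EFinM; apply: le_trans (CP _) => //.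
apply: (@le_trans _ _
    ((2^-1 * t)%:E * mu (superlevel (M \1_E) (2^-1 * t)) `^ p^-1)).
  rewrite EFinM lee_wpmul2l//; first by rewrite lee_fin mulr_ge0// ltW.
  rewrite -poweR_EFin -muF gt0_ler_poweR// ?in_itv/= ?leey ?andbT//.
  - by rewrite invr_ge0 ltW.
  - apply: le_counting.
    move=> x /tF tx; rewrite /superlevel/=; apply: lt_le_trans (lee_abs _).
    by apply: lt_le_trans tx; rewrite lte_fin; lra.
rewrite /lorentz_norm; apply: ereal_sup_ubound; apply: imageP.
by rewrite /= in_itv/= andbT mulr_gt0.
Qed.

Lemma bounded_on_Lp_test (p : R) : (0 < p)%R ->
  bounded_on_Lp mu M p%:E -> indicator_estimate p.
Proof.
move=> p0 [C CP]; exists C => E F e phi t muE muF t0 tF.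
have norm_E : 'N[mu]_p%:E[EFin \o \1_E] = (e `^ p^-1)%:E.
  rewrite unlock -poweR_EFin -muE -[E in RHS]setIT -integral_indic//.
  congr (_ `^ _); apply: eq_integral => x _ /=; rewrite indicE.
  by case: (x \in E); rewrite /= ?normr1 ?normr0 ?powR1 ?powR0 ?gt_eqF.
have := CP \1_E; rewrite norm_E => /(_ _ (ltry _)) {}CP.
have phi0 : (0 <= phi)%R by rewrite -lee_fin -muF (measure_ge0 mu).
rewrite -lee_fin [leRHS]EFinM; apply: le_trans (CP _) => //.
have -> : (t * phi `^ p^-1 = (t `^ p * phi) `^ p^-1)%R.
  by rewrite powRM ?powR_ge0// -powRrM mulfV ?gt_eqF// powRr1 ?ltW.
rewrite unlock -poweR_EFin gt0_ler_poweR ?in_itv/= ?leey ?andbT//.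
- by rewrite invr_ge0 ltW.
- by rewrite lee_fin mulr_ge0 ?powR_ge0.
- by rewrite integral_ge0// => x _; rewrite poweR_ge0.
apply: (@le_trans _ _ (\int[mu]_(x in F) `|M \1_E x| `^ p)); last first.
  by apply: ge0_subset_integral => // x _; rewrite poweR_ge0.
rewrite EFinM -muF -integral_cst//; apply: ge0_le_integral => //.
- by move=> x _; rewrite lee_fin powR_ge0.
- move=> x /tF tx.
  rewrite /= -poweR_EFin gt0_ler_poweR ?in_itv/= ?leey ?andbT//.
  + exact: ltW.
  + by rewrite lee_fin ltW.
  exact: le_trans tx (lee_abs _).
Qed.
End test_inequality.

(** * Exponential against quadratic growth *)

Lemma powR_exprn {R : realType} (x r : R) (n : nat) :
  0 <= x -> (x ^+ n) `^ r = (x `^ r) ^+ n.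
Proof. by move=> x0; rewrite -!powR_mulrn ?powR_ge0// -!powRrM mulrC. Qed.

Lemma bernoulli_ineq {R : realDomainType} (d : R) (n : nat) :
  0 <= d -> n%:R * d <= (1 + d) ^+ n.
Proof.
move=> d0; elim: n => [|n IHn]; first by rewrite mul0r.
have d1 : 1 <= (1 + d) ^+ n by rewrite exprn_ege1// lerDl.
rewrite exprS -natr1; nra.
Qed.

(** By the Bernoulli inequality for the cube root of q, q ^ n is at least a
    positive multiple of n ^ 3. *)
Lemma exponential_not_quadratic {R : realType} (q K : R) (c : nat) : 1 < q ->
  ~ forall n : nat, q ^+ n <= K * (c * n).+1%:R ^+ 2.
Proof.
move=> q1 qK; have q0 : 0 < q by rewrite (lt_trans ltr01).
pose u := q `^ 3^-1; have u3 : u ^+ 3 = q.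
  by rewrite -powR_mulrn ?powR_ge0// -powRrM mulVf// powRr1// ltW.
have u1 : 1 < u.
  have := gt0_ltr_powR (r := 3^-1 : R) _ _ _ q1; rewrite powR1; apply.
  - by rewrite invr_gt0.
  - by rewrite nnegrE.
  - by rewrite nnegrE ltW.
pose d := u - 1; have d0 : 0 < d by rewrite subr_gt0.
pose B := `|K| * c.+1%:R ^+ 2 / d ^+ 3.
have B0 : 0 <= B by rewrite divr_ge0 ?mulr_ge0 ?exprn_ge0// ltW.
pose n := Num.Def.archi_bound B.
have Bn : B < n%:R by exact: archi_boundP.
have n0 : 0 < n%:R :> R by exact: le_lt_trans Bn.
have nd : (n%:R * d) ^+ 3 <= q ^+ n.
  rewrite -u3 exprAC lerXn2r//.
  - by rewrite nnegrE mulr_ge0// ltW.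
  - by rewrite nnegrE exprn_ge0// powR_ge0.
  by have := bernoulli_ineq d n (ltW d0); rewrite subrKC.
have qn : q ^+ n <= `|K| * c.+1%:R ^+ 2 * n%:R ^+ 2.
  apply: le_trans (qK n) _; rewrite -mulrA -exprMn.
  apply: (@le_trans _ _ (`|K| * (c * n).+1%:R ^+ 2)).
    by rewrite ler_wpM2r ?exprn_ge0// ler_norm.
  rewrite ler_wpM2l// lerXn2r ?nnegrE ?mulr_ge0// -natrM ler_nat mulSn.
  by move: n0; rewrite ltr0n; lia.
have : n%:R * d ^+ 3 <= `|K| * c.+1%:R ^+ 2.
  rewrite -(ler_pM2r (exprn_gt0 2 n0)) (le_trans _ qn)// (le_trans _ nd)//.
  by rewrite exprMn le_eqVlt; apply/orP; left; apply/eqP; ring.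
by rewrite leNgt -ltr_pdivrMr ?exprn_gt0// Bn.
Qed.

(** For m = a ^ 2 and s = a m, the binomial terms m ^ s and s m ^ (s - 1) of
    (m + 1) ^ s already exceed a m ^ s = a ^ (2 s + 1). *)
Lemma superquadratic_exponent (a b : nat) : (0 < a)%N -> (a ^ 2 < b)%N ->
  exists s, forall k, (a ^ (2 * (s * k) + k) <= b ^ (s * k))%N.
Proof.
move=> a0 ab; pose m := (a ^ 2)%N; have m0 : (0 < m)%N by rewrite expn_gt0 a0.
have growth s : (m ^ s * (m + s) <= m.+1 ^ s * m)%N.
  elim: s => [|s IHs]; first by rewrite addn0.
  rewrite !expnS -mulnA (leq_trans _ (_ : m.+1 * (m ^ s * (m + s)) <= _)%N)//.
    by rewrite mulnCA (mulnCA m.+1) leq_mul2l; apply/orP; right; nia.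
  by rewrite -mulnA leq_mul2l IHs orbT.
exists (a * m)%N => k.
have -> : (2 * (a * m * k) + k = (2 * (a * m) + 1) * k)%N by lia.
rewrite 2!expnM leq_expn2r// (leq_trans _ (leq_expn2r m.+1 b _ ab))//.
rewrite expnD expn1 expnM -/m -(leq_pmul2r m0).
apply: leq_trans (growth _); rewrite -mulnA leq_mul2l leq_addl orbT //.
Qed.

(** * Failure of the indicator estimate *)

Section unboundedness.
Context {R : realType} (a b : nat).
Context {V : pointedType} (adj : rel V) (w : nat -> V).
Hypotheses (ha : (2 <= a)%N) (hab : (a < b)%N) (hS : is_Sab R a b adj w).
Variable p : R.
Hypothesis p0 : 0 < p.

(** The indicator estimate for the sets of [descendant_test_sets], where
    t = b ^ e / ((n + k + e + 1) ^ 2 * A). *)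
Lemma indicator_estimate_growth : indicator_estimate (@maximal V R adj) p ->
  exists K : R, forall n k e A : nat, (e <= n)%N -> (0 < A)%N ->
    (forall j i, (j + i <= n + k + e)%N ->
       (ndesc a b (j%:Z - k%:Z) i <= A)%N) ->
    (b ^ e)%:R * (b ^ n * a ^ k)%:R `^ p^-1 <=
      K * (b ^ e)%:R `^ p^-1 * ((n + k + e).+1 ^ 2 * A)%:R.
Proof.
move=> [K KP]; exists K => n k e A en A0 nA.
have [E [F [uE uF sE sF EF]]] :=
  descendant_test_sets R a b V adj w hS n k e A en nA.
have be0 : (0 < b ^ e)%N by rewrite expn_gt0; lia.
have N0 : 0 < ((n + k + e).+1 ^ 2 * A)%:R :> R.
  by rewrite ltr0n muln_gt0 A0 expn_gt0.
rewrite -ler_pdivrMr// mulrAC -sF -[X in _ <= K * X%:R `^ _]sE.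
apply: (KP [set` E] [set` F]).
- by rewrite -counting_seq.
- by rewrite -counting_seq.
- by rewrite divr_gt0// ltr0n.
move=> x /EF[Er [s [rs ss]]].
have E0 : (0 < size E)%N by rewrite sE.
apply: le_trans (maximal_indic_ge _ _ _ _ _ uE E0 Er rs).
have s0 : (0 < size s)%N.
  by apply: leq_trans E0 _; apply: uniq_leq_size => // y yE; exact/rs/Er.
by rewrite lee_fin sE ler_wpM2l// lef_pV2 ?posrE// ?ltr0n// ler_nat.
Qed.

(** E = {w_n}, F at height 0 and A = a ^ n, for n tending to infinity. *)
Lemma no_indicator_estimate_subquadratic : (b <= a ^ 2)%N ->
  p < log_base a%:R b%:R -> ~ indicator_estimate (@maximal V R adj) p.
Proof.
move=> ba ptau /indicator_estimate_growth[K KP].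
have a1 : 1 < a%:R :> R by rewrite ltr1n.
have a0 : 0 < a%:R :> R by rewrite (lt_trans ltr01).
have b0 : 0 < b%:R :> R by rewrite (lt_trans a0) ?ltr_nat.
have q1 : 1 < b%:R `^ p^-1 / a%:R.
  rewrite ltr_pdivlMr// mul1r.
  have -> : a%:R = (a%:R `^ p) `^ p^-1 :> R.
    by rewrite -powRrM mulfV ?gt_eqF// powRr1// ltW.
  apply: gt0_ltr_powR; rewrite ?invr_gt0// ?nnegrE ?powR_ge0//.
  by rewrite -ltr_ln ?posrE ?powR_gt0// ln_powR -ltr_pdivlMr ?ln_gt0.
apply: (exponential_not_quadratic _ K 1 q1) => n.
have an0 : (0 < a ^ n)%N by rewrite expn_gt0 ltnW.
have nA j i : (j + i <= n + 0 + 0)%N -> (ndesc a b (j%:Z - 0%:Z) i <= a ^ n)%N.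
  by rewrite !addn0 subr0 => jin; rewrite ndesc_subquadratic// ltnW.
have := KP n 0%N 0%N (a ^ n)%N (leq0n _) an0 nA.
rewrite !addn0 expn0 muln1 mul1r powR1 mulr1 mul1n natrM !natrX mulrA => Kn.
rewrite expr_div_n ler_pdivrMr ?exprn_gt0//; apply: le_trans Kn.
by rewrite powR_exprn// ltW.
Qed.

(** E at height 0, F at height -k and A = b ^ n with n = s k, for k tending to
    infinity. *)
Lemma no_indicator_estimate_superquadratic : (a ^ 2 < b)%N ->
  ~ indicator_estimate (@maximal V R adj) p.
Proof.
move=> ab /indicator_estimate_growth[K KP].
have a1 : 1 < a%:R :> R by rewrite ltr1n.
have a0 : 0 < a%:R :> R by rewrite (lt_trans ltr01).
have b0 : 0 < b%:R :> R by rewrite (lt_trans a0) ?ltr_nat.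
have q1 : 1 < a%:R `^ p^-1 :> R.
  have := gt0_ltr_powR (r := p^-1) _ _ _ a1; rewrite powR1; apply.
  - by rewrite invr_gt0.
  - by rewrite nnegrE.
  - by rewrite nnegrE ltW.
have [s sP] := superquadratic_exponent a b (ltnW ha) ab.
apply: (exponential_not_quadratic _ K (2 * s + 1) q1) => k.
pose n := (s * k)%N.
have nb0 : (0 < b ^ n)%N by rewrite expn_gt0; lia.
have bn0 : 0 < (b ^ n)%:R :> R by rewrite ltr0n.
have nA j i : (j + i <= n + k + n)%N -> (ndesc a b (j%:Z - k%:Z) i <= b ^ n)%N.
  by move=> jin; apply: ndesc_superquadratic; rewrite ?sP//; lia.
have := KP n k n (b ^ n)%N (leqnn _) nb0 nA.
have -> : (n + k + n).+1 = ((2 * s + 1) * k).+1 by rewrite /n; lia.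
rewrite (natrM _ (b ^ n)) (natrM _ (_ ^ 2)) powRM// => Kn.
have bp0 : 0 < (b ^ n)%:R * (b ^ n)%:R `^ p^-1 :> R.
  by rewrite mulr_gt0// powR_gt0.
rewrite -(ler_pM2l bp0).
have -> : (a%:R `^ p^-1) ^+ k = (a ^ k)%:R `^ p^-1 :> R.
  by rewrite natrX powR_exprn// ltW.
rewrite -mulrA (le_trans Kn)// natrX le_eqVlt; apply/orP; left; apply/eqP; ring.
Qed.

End unboundedness.

Theorem proposition3p3 (R : realType) (a b : nat)
    (ha : (2 <= a)%N) (hab : (a < b)%N)
    (V : pointedType) (adj : rel V) (w : nat -> V)
    (hS : is_Sab R a b adj w) :
  let mu : {measure set (vertices V) -> \bar R} := counting in
  let M : (vertices V -> R) -> vertices V -> \bar R := maximal adj in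
  let tau : R := log_base a%:R b%:R in
  ((b <= a ^ 2)%N ->
    forall p : R, 1 <= p < tau ->
      ~ restricted_weak_type mu M p /\ ~ bounded_on_Lp mu M p%:E) /\
  ((a ^ 2 < b)%N ->
    (forall p : R, 1 < p -> ~ restricted_weak_type mu M p) /\
    (forall p : \bar R, (1 <= p)%E -> (bounded_on_Lp mu M p <-> p = +oo%E))).
Proof.
move=> mu M tau; split=> [ba p /andP[p1 ptau]|ab].
  have p0 : 0 < p by rewrite (lt_le_trans ltr01).
  have no :=
    no_indicator_estimate_subquadratic a b adj w ha hab hS p p0 ba ptau.
  split; [move=> /(restricted_weak_type_test _ _ p0)|
          move=> /(bounded_on_Lp_test _ _ p0)]; exact: no.
have no p (p0 : 0 < p) :=
  no_indicator_estimate_superquadratic a b adj w ha hab hS p p0 ab.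
split => [p p1|[p| |]//].
- have p0 : 0 < p by rewrite (lt_trans ltr01).
  by move=> /(restricted_weak_type_test _ _ p0); exact: no.
- rewrite lee_fin => p1; have p0 : 0 < p by rewrite (lt_le_trans ltr01).
  by split => // /(bounded_on_Lp_test _ _ p0)/(no p p0).
- by split => // _; exact: maximal_bounded_Loo.
Qed.
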